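(* Let $(X,d)$ be a compact ultrametric space and let $k$ be a positive integer. Then there exists a Lipschitz map from $X$ onto the cube $[0,1]^k$ if and only if $\mathcal{H}^k(X)>0$.
   Context: An ultrametric space is a metric space $(X,d)$ satisfying $d(x,y)\le\max(d(x,z),d(y,z))$ for all $x,y,z\in X$. $\mathcal{H}^k$ denotes the $k$-dimensional Hausdorff measure. *)

(* Defs.v *)
From Stdlib Require Import Reals Lra Lia Classical ClassicalEpsilon.
Open Scope R_scope.

Section Metric.
Context {X : Type} (d : X -> X -> R).

Definition is_ultrametric : Prop :=
  (forall x y, 0 <= d x y) /\
  (forall x y, d x y = 0 <-> x = y) /\
  (forall x y, d x y = d y x) /\
  (forall x y z, d x y <= Rmax (d x z) (d y z)).

Definition open_set (U : X -> Prop) : Prop :=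
  forall x, U x -> exists r, 0 < r /\ forall y, d x y < r -> U y.

Definition compact_space : Prop :=
  forall (I : Type) (U : I -> X -> Prop),
    (forall i, open_set (U i)) ->
    (forall x, exists i, U i x) ->
    exists l : list I, forall x, exists i, List.In i l /\ U i x.

(** Diameter of a set A (0 for the empty set; sup of distances otherwise;
    every subset of a compact space is bounded, so the sup exists there). *)
Definition diam (A : X -> Prop) : R :=
  epsilon (inhabits 0)
    (fun s => ((forall x, ~ A x) /\ s = 0) \/
              is_lub (fun v => exists x y, A x /\ A y /\ v = d x y) s).

(** For a series of nonnegative terms [a], "c <= sum_{n>=0} a n" in [0,+oo]:
    the supremum of the partial sums is at least c. *)
Definition series_ge (a : nat -> R) (c : R) : Prop :=
  forall c', c' < c -> exists N, c' < sum_f_R0 a N.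

(** c <= H^k_delta(X): every countable cover of X by sets of diameter at most
    delta has sum of diam^k at least c (H^k_delta is the infimum of these sums). *)
Definition hausdorff_delta_ge (k : nat) (delta c : R) : Prop :=
  forall E : nat -> X -> Prop,
    (forall x, exists n, E n x) ->
    (forall n, diam (E n) <= delta) ->
    series_ge (fun n => diam (E n) ^ k) c.

(** H^k(X) > 0, where H^k(X) = sup_{delta>0} H^k_delta(X). *)
Definition hausdorff_measure_pos (k : nat) : Prop :=
  exists delta c, 0 < delta /\ 0 < c /\ hausdorff_delta_ge k delta c.

End Metric.

(** Points of R^k are represented as functions nat -> R; only coordinates
    i < k are relevant. *)
Fixpoint sqsum (k : nat) (u v : nat -> R) : R :=
  match k with
  | O => 0
  | S k' => sqsum k' u v + (u k' - v k') ^ 2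
  end.

Definition eucl_dist (k : nat) (u v : nat -> R) : R := sqrt (sqsum k u v).

Definition in_cube (k : nat) (y : nat -> R) : Prop :=
  forall i, (i < k)%nat -> 0 <= y i <= 1.

Definition lipschitz {X : Type} (d : X -> X -> R) (k : nat) (f : X -> nat -> R) : Prop :=
  exists L, 0 <= L /\ forall x y, eucl_dist k (f x) (f y) <= L * d x y.

Definition onto_cube {X : Type} (k : nat) (f : X -> nat -> R) : Prop :=
  (forall x, in_cube k (f x)) /\
  (forall y, in_cube k y -> exists x, forall i, (i < k)%nat -> f x i = y i).

(* Main.v *)
Require Import Defs.
From Stdlib Require Import Reals Lra Lia Psatz Classical ClassicalEpsilon List.
Open Scope R_scope.

(** If a Lipschitz map onto the cube exists, compactness and the fact that
    ultrametric balls are open reduce any countable cover of [X] to a finite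
    cover by balls; their images lie in boxes covering the cube, and counting
    the points of a fine grid bounds the sum of the volumes of the boxes below.

    Conversely, order [X] linearly so that balls are (almost) convex, and let
    [g x] be the [k]-dimensional Hausdorff content of the initial segment
    [{z | z <= x}].  Subadditivity of the content alone gives
    [|g x - g y| <= (2 d(x,y))^k], and [g] has no jumps, so its image is dense
    in [[0, g_max]], where [g_max > 0] is the content of [X].  Composing [g / g_max]
    with a Peano curve [[0,1] -> [0,1]^k] that is Hoelder of exponent [1/k] gives
    a Lipschitz map with dense, hence (by compactness) full image. *)

(** * A Hoelder continuous Peano curve *)

Section Peano.
Context (k : nat).

(* [a] is the leading ternary digit of the parameter and [y] the value of the
   curve at the remaining digits; the roles of the coordinates are shifted
   cyclically, so that each step refines a single coordinate. *)
Definition peano_step (a : nat) (y : nat -> R) (i : nat) : R :=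
  match i with
  | O => (INR a + y (k - 1)%nat) / 3
  | S j => if Nat.odd a then 1 - y j else y j
  end.

(** Stage 0 is the diagonal of the cube, so every stage runs from the all-zero corner to the all-one
    corner; together with the reflection at odd digits this makes consecutive thirds join. *)
Fixpoint peano_approx (n : nat) (t : R) : nat -> R :=
  match n with
  | O => fun _ => t
  | S n' =>
      if Rle_dec t (1/3) then peano_step 0 (peano_approx n' (3 * t))
      else if Rle_dec t (2/3) then peano_step 1 (peano_approx n' (3 * t - 1))
      else peano_step 2 (peano_approx n' (3 * t - 2))
  end.

(* A bound for the variation of coordinate [i] over a ternary interval of length [3^-n]. *)
Fixpoint osc (n i : nat) : R :=
  match n, i with
  | O, _ => 1
  | S n', O => osc n' (k - 1)%nat / 3
  | S n', S j => osc n' j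
  end.

Lemma osc_pos n i : 0 < osc n i.
Proof.
  revert i; induction n as [|n IH]; intros [|i]; simpl; try lra; auto.
  specialize (IH (k - 1)%nat); lra.
Qed.

(** Coordinate [i] waits [i] steps and is then divided by 3 once every [k] steps, hence at least
    [(n - i) / k] times in [n] steps. This rate is the source of the Hoelder exponent [1/k]. *)
Lemma osc_pow (Hk : (1 <= k)%nat) n i : osc n i ^ k <= 3 ^ i * (/ 3) ^ n.
Proof.
  revert i; induction n as [|n IH]; intros [|i].
  - simpl osc; rewrite pow1; simpl; lra.
  - simpl osc; rewrite pow1, pow_O, Rmult_1_r. apply pow_R1_Rle; lra.
  - simpl osc. unfold Rdiv. rewrite Rpow_mult_distr.
    specialize (IH (k - 1)%nat).
    assert (E : 3 ^ (k - 1) * (/ 3) ^ n * (/ 3) ^ k = (/ 3) ^ S n).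
    { replace k with (S (k - 1)) at 2 by lia. simpl.
      rewrite !pow_inv. field. split; apply pow_nonzero; lra. }
    rewrite pow_O, Rmult_1_l, <- E. apply Rmult_le_compat_r; auto.
    apply pow_le; lra.
  - simpl osc. eapply Rle_trans; [apply IH|]. simpl. apply Req_le. field.
Qed.

Lemma ternary_digit t : 0 <= t <= 1 ->
  exists a s, (a = 0 \/ a = 1 \/ a = 2)%nat /\ 0 <= s <= 1 /\ t = (INR a + s) / 3.
Proof.
  intros Ht. destruct (Rle_dec t (1/3)).
  - exists 0%nat, (3 * t); simpl; repeat split; auto; lra.
  - destruct (Rle_dec t (2/3)).
    + exists 1%nat, (3 * t - 1); simpl; repeat split; auto; lra.
    + exists 2%nat, (3 * t - 2); simpl; repeat split; auto; lra.
Qed.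

Lemma peano_endpoints n : (forall i, peano_approx n 0 i = 0) /\ (forall i, peano_approx n 1 i = 1).
Proof.
  induction n as [|n [IH0 IH1]]; [now split|].
  split; intros i; simpl.
  - destruct (Rle_dec 0 (1/3)); [|lra]. rewrite Rmult_0_r.
    destruct i; simpl; rewrite IH0; lra.
  - destruct (Rle_dec 1 (1/3)); [lra|]. destruct (Rle_dec 1 (2/3)); [lra|].
    replace (3 * 1 - 2) with 1 by ring.
    destruct i; simpl; rewrite IH1; lra.
Qed.

(* The closed thirds overlap at [1/3] and [2/3]; there the two formulas agree
   because of the values of the curve at the endpoints. *)
Lemma peano_approx_S n a s i : (a = 0 \/ a = 1 \/ a = 2)%nat -> 0 <= s <= 1 ->
  peano_approx (S n) ((INR a + s) / 3) i = peano_step a (peano_approx n s) i.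
Proof.
  intros Ha Hs. destruct (peano_endpoints n) as [P0 P1].
  destruct Ha as [-> | [-> | ->]]; simpl.
  - destruct (Rle_dec ((0 + s) / 3) (1/3)) as [H|H]; [|lra].
    replace (3 * ((0 + s) / 3)) with s by field. reflexivity.
  - destruct (Rle_dec ((1 + s) / 3) (1/3)) as [H|H].
    + replace s with 0 by lra. replace (3 * ((1 + 0) / 3)) with 1 by field.
      destruct i; simpl; rewrite P0, P1; lra.
    + destruct (Rle_dec ((1 + s) / 3) (2/3)) as [H'|H']; [|lra].
      replace (3 * ((1 + s) / 3) - 1) with s by field. reflexivity.
  - destruct (Rle_dec ((1 + 1 + s) / 3) (1/3)) as [H|H]; [lra|].
    destruct (Rle_dec ((1 + 1 + s) / 3) (2/3)) as [H'|H'].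
    + replace s with 0 by lra. replace (3 * ((1 + 1 + 0) / 3) - 1) with 1 by field.
      destruct i; simpl; rewrite P0, P1; lra.
    + replace (3 * ((1 + 1 + s) / 3) - 2) with s by field. reflexivity.
Qed.

Lemma peano_step_cube a y : (a = 0 \/ a = 1 \/ a = 2)%nat ->
  (forall i, 0 <= y i <= 1) -> forall i, 0 <= peano_step a y i <= 1.
Proof.
  intros Ha Hy [|i]; simpl.
  - specialize (Hy (k - 1)%nat). destruct Ha as [-> | [-> | ->]]; simpl; lra.
  - specialize (Hy i). destruct (Nat.odd a); lra.
Qed.

Lemma peano_approx_cube n t : 0 <= t <= 1 -> forall i, 0 <= peano_approx n t i <= 1.
Proof.
  revert t; induction n as [|n IH]; intros t Ht i; [exact Ht|].
  destruct (ternary_digit t Ht) as (a & s & Ha & Hs & ->).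
  rewrite peano_approx_S by auto. apply peano_step_cube; auto.
Qed.

Lemma peano_step_contract a y y' n C i :
  (forall j, Rabs (y j - y' j) <= C * osc n j) ->
  Rabs (peano_step a y i - peano_step a y' i) <= C * osc (S n) i.
Proof.
  intros H. destruct i as [|i]; simpl.
  - specialize (H (k - 1)%nat).
    replace (_ - _) with ((y (k - 1)%nat - y' (k - 1)%nat) * / 3) by field.
    rewrite Rabs_mult, (Rabs_right (/ 3)) by lra. lra.
  - specialize (H i). destruct (Nat.odd a); [|exact H].
    replace (_ - _) with (- (y i - y' i)) by ring. now rewrite Rabs_Ropp.
Qed.

(** Both stages read the same first [n] digits; once these are peeled off, two points of the unit
    cube remain, at distance at most 1 in each coordinate. *)
Lemma peano_approx_cauchy n m t i : 0 <= t <= 1 ->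
  Rabs (peano_approx (n + m) t i - peano_approx n t i) <= osc n i.
Proof.
  revert t i; induction n as [|n IH]; intros t i Ht.
  - simpl. pose proof (peano_approx_cube m t Ht i). apply Rabs_le; lra.
  - destruct (ternary_digit t Ht) as (a & s & Ha & Hs & ->).
    change (S n + m)%nat with (S (n + m)).
    rewrite !peano_approx_S by auto. rewrite <- Rmult_1_l.
    apply peano_step_contract. intros j. rewrite Rmult_1_l. auto.
Qed.

(** The first [n] digits of such a [t] can all be taken to be 0, and each of them shrinks one
    coordinate towards 0. *)
Lemma peano_near_0 n t i : 0 <= t <= (/ 3) ^ n -> peano_approx n t i <= osc n i.
Proof.
  revert t i; induction n as [|n IH]; intros t i Ht; [simpl in *; lra|].
  assert (P : (/ 3) ^ n <= 1) by (rewrite <- (pow1 n); apply pow_incr; lra).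
  simpl pow in Ht.
  replace t with ((INR 0 + 3 * t) / 3) by (simpl; field).
  rewrite peano_approx_S by (auto; lra).
  assert (I : forall j, peano_approx n (3 * t) j <= osc n j) by (intros; apply IH; lra).
  destruct i; simpl; [specialize (I (k - 1)%nat); lra | apply I].
Qed.

Lemma peano_near_1 n t i : 0 <= 1 - t <= (/ 3) ^ n -> 1 - peano_approx n t i <= osc n i.
Proof.
  revert t i; induction n as [|n IH]; intros t i Ht; [simpl in *; lra|].
  assert (P : (/ 3) ^ n <= 1) by (rewrite <- (pow1 n); apply pow_incr; lra).
  simpl pow in Ht.
  replace t with ((INR 2 + (3 * t - 2)) / 3) by (simpl; field).
  rewrite peano_approx_S by (auto; lra).
  assert (I : forall j, 1 - peano_approx n (3 * t - 2) j <= osc n j) by (intros; apply IH; lra).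
  destruct i; simpl; [specialize (I (k - 1)%nat); lra | apply I].
Qed.

(** Adjacent pieces share an endpoint, and either value is within [osc (S n) i] of it; hence the
    factor 2. *)
Lemma peano_approx_junction n a s s' i : (a = 0 \/ a = 1)%nat ->
  0 <= 1 - s <= (/ 3) ^ n -> 0 <= s' <= (/ 3) ^ n ->
  Rabs (peano_step a (peano_approx n s) i - peano_step (S a) (peano_approx n s') i)
    <= 2 * osc (S n) i.
Proof.
  intros Ha Hs Hs'.
  assert (P : (/ 3) ^ n <= 1) by (rewrite <- (pow1 n); apply pow_incr; lra).
  assert (I : forall j, 0 <= 1 - peano_approx n s j <= osc n j).
  { intros j. pose proof (peano_near_1 n s j Hs).
    pose proof (peano_approx_cube n s ltac:(lra) j). lra. }
  assert (J : forall j, 0 <= peano_approx n s' j <= osc n j).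
  { intros j. pose proof (peano_near_0 n s' j Hs').
    pose proof (peano_approx_cube n s' ltac:(lra) j). lra. }
  apply Rabs_le.
  destruct i as [|i]; destruct Ha as [-> | ->]; simpl;
    [specialize (I (k - 1)%nat); specialize (J (k - 1)%nat) ..
    |specialize (I i); specialize (J i)|specialize (I i); specialize (J i)]; lra.
Qed.

Lemma peano_approx_modulus_lt n t t' i : 0 <= t -> t <= t' -> t' <= 1 -> t' - t <= (/ 3) ^ n ->
  Rabs (peano_approx n t i - peano_approx n t' i) <= 2 * osc n i.
Proof.
  revert t t' i; induction n as [|n IH]; intros t t' i H0 Hle H1 Hd.
  - simpl in *. apply Rabs_le; lra.
  - assert (P : (/ 3) ^ n <= 1) by (rewrite <- (pow1 n); apply pow_incr; lra).
    simpl pow in Hd.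
    destruct (ternary_digit t) as (a & s & Ha & Hs & ->); [lra|].
    destruct (ternary_digit t') as (a' & s' & Ha' & Hs' & ->); [lra|].
    rewrite !peano_approx_S by auto.
    destruct (Nat.eq_dec a a') as [<- | Hne].
    + apply peano_step_contract. intros j. apply IH; lra.
    + destruct Ha as [-> | [-> | ->]], Ha' as [-> | [-> | ->]]; simpl in *; try lia;
        try lra.
      * apply (peano_approx_junction n 0); auto; lra.
      (* Digits 0 and 2 can only occur for the parameters [1/3] and [2/3] with [n = 0], where the
         bound is checked directly. *)
      * assert (Es : s = 1) by lra. assert (Es' : s' = 0) by lra. subst.
        assert (En : (/ 3) ^ n = 1) by lra.
        assert (Hn : n = 0%nat).
        { destruct n; auto. simpl in En.
          assert ((/ 3) ^ n <= 1) by (rewrite <- (pow1 n); apply pow_incr; lra). lra. }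
        subst. destruct i; simpl; apply Rabs_le; lra.
      (* The digits decrease although the parameters do not, so both expansions name the same
         boundary point of two thirds. *)
      * assert (Es : s = 0) by lra. assert (Es' : s' = 1) by lra. subst.
        destruct (peano_endpoints n) as [P0 P1].
        pose proof (osc_pos n (k - 1)). pose proof (osc_pos n (i - 1)).
        destruct i; simpl in *; rewrite P0, P1; apply Rabs_le; rewrite ?Nat.sub_0_r in *; lra.
      * apply (peano_approx_junction n 1); auto; lra.
      * assert (Es : s = 0) by lra. assert (Es' : s' = 1) by lra. subst.
        destruct (peano_endpoints n) as [P0 P1].
        pose proof (osc_pos n (k - 1)). pose proof (osc_pos n (i - 1)).
        destruct i; simpl in *; rewrite P0, P1; apply Rabs_le; rewrite ?Nat.sub_0_r in *; lra.
Qed.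

Lemma peano_approx_modulus n t t' i : 0 <= t <= 1 -> 0 <= t' <= 1 -> Rabs (t - t') <= (/ 3) ^ n ->
  Rabs (peano_approx n t i - peano_approx n t' i) <= 2 * osc n i.
Proof.
  intros H H' Hd. destruct (Rle_dec t t').
  - apply peano_approx_modulus_lt; try lra. rewrite Rabs_minus_sym, Rabs_right in Hd; lra.
  - rewrite Rabs_minus_sym. apply peano_approx_modulus_lt; try lra.
    rewrite Rabs_right in Hd; lra.
Qed.

(** The digits of [t] are read off the coordinates of [y] in cyclic order, undoing one [peano_step]
    at a time. *)
Lemma peano_approx_dense (Hk : (1 <= k)%nat) n y : in_cube k y ->
  exists t, 0 <= t <= 1 /\ forall i, (i < k)%nat -> Rabs (peano_approx n t i - y i) <= osc n i.
Proof.
  revert y; induction n as [|n IH]; intros y Hy.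
  - exists 0. split; [lra|]. intros i Hi. specialize (Hy i Hi). simpl. apply Rabs_le; lra.
  - destruct (ternary_digit (y 0%nat)) as (a & s & Ha & Hs & Ey); [apply Hy; lia|].
    (* [z] is the preimage of [y] under [peano_step a]: the remainder of coordinate 0 goes last, the
       others shift down, reflected if [a] is odd. *)
    set (z := fun i => if Nat.eq_dec i (k - 1) then s
                       else if Nat.odd a then 1 - y (S i) else y (S i)).
    destruct (IH z) as (t & Ht & Hz).
    { intros i Hi. unfold z. destruct (Nat.eq_dec i (k - 1)); [exact Hs|].
      specialize (Hy (S i) ltac:(lia)). destruct (Nat.odd a); lra. }
    exists ((INR a + t) / 3). split.
    { destruct Ha as [-> | [-> | ->]]; simpl; lra. }
    intros i Hi. rewrite peano_approx_S by auto.
    destruct i as [|i]; simpl.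
    + specialize (Hz (k - 1)%nat ltac:(lia)). unfold z in Hz.
      destruct (Nat.eq_dec (k - 1) (k - 1)); [|lia].
      rewrite Ey. replace (_ - _) with ((peano_approx n t (k - 1)%nat - s) * / 3) by field.
      rewrite Rabs_mult, (Rabs_right (/ 3)) by lra. lra.
    + specialize (Hz i ltac:(lia)). unfold z in Hz.
      destruct (Nat.eq_dec i (k - 1)); [lia|].
      destruct (Nat.odd a); [|exact Hz].
      rewrite <- Rabs_Ropp. replace (- _) with (peano_approx n t i - (1 - y (S i))) by ring.
      exact Hz.
Qed.

Lemma osc_small (Hk : (1 <= k)%nat) i eps : 0 < eps -> exists n, osc n i < eps.
Proof.
  intros He.
  assert (H3 : 0 < 3 ^ i) by (apply pow_lt; lra).
  assert (Hek : 0 < eps ^ k) by (apply pow_lt; lra).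
  destruct (pow_lt_1_zero (/ 3)) with (y := eps ^ k / 3 ^ i) as [n Hn].
  - rewrite Rabs_right; lra.
  - apply Rdiv_lt_0_compat; lra.
  - exists n. specialize (Hn n (le_n _)).
    rewrite Rabs_right in Hn by (apply Rle_ge, pow_le; lra).
    apply Rnot_le_lt. intros Hle.
    assert (eps ^ k <= osc n i ^ k) by (apply pow_incr; lra).
    pose proof (osc_pow Hk n i).
    apply (Rmult_lt_compat_l (3 ^ i)) in Hn; auto.
    replace (3 ^ i * (eps ^ k / 3 ^ i)) with (eps ^ k) in Hn by (field; lra). lra.
Qed.

Lemma osc_antitone_S n i : osc (S n) i <= osc n i.
Proof.
  revert i; induction n as [|n IH]; intros [|i]; simpl; try lra.
  - specialize (IH (k - 1)%nat). simpl in IH. lra.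
  - apply IH.
Qed.

(** The stages are Cauchy by [peano_approx_cauchy], and its non-strict bound survives the passage to
    the limit. *)
Lemma peano_limit (Hk : (1 <= k)%nat) t i : 0 <= t <= 1 ->
  exists p, forall n, Rabs (p - peano_approx n t i) <= osc n i.
Proof.
  intros Ht.
  destruct (R_complete (fun n => peano_approx n t i)) as [p Hp].
  - intros eps He. destruct (osc_small Hk i (eps / 2)) as [N HN]; [lra|].
    exists N. intros n m Hn Hm. unfold Rdist.
    pose proof (peano_approx_cauchy N (n - N) t i Ht) as A.
    pose proof (peano_approx_cauchy N (m - N) t i Ht) as B.
    replace (N + (n - N))%nat with n in A by lia.
    replace (N + (m - N))%nat with m in B by lia.
    unfold Rabs in *; repeat destruct Rcase_abs; lra.
  - exists p. intros n. apply Rnot_lt_le. intros Hlt.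
    destruct (Hp (Rabs (p - peano_approx n t i) - osc n i)) as [N HN]; [lra|].
    specialize (HN (n + N)%nat ltac:(lia)). unfold Rdist in HN.
    pose proof (peano_approx_cauchy n N t i Ht).
    unfold Rabs in *; repeat destruct Rcase_abs; lra.
Qed.

End Peano.

Lemma inv3_pow_bracket r : 0 < r <= 1 -> exists n, (/ 3) ^ S n < r <= (/ 3) ^ n.
Proof.
  intros Hr.
  destruct (pow_lt_1_zero (/ 3)) with (y := r) as [N HN]; [rewrite Rabs_right; lra|lra|].
  specialize (HN N (le_n _)). rewrite Rabs_right in HN by (apply Rle_ge, pow_le; lra).
  induction N as [|N IH]; [simpl in HN; lra|].
  destruct (Rlt_le_dec ((/ 3) ^ N) r); [auto|]. exists N; lra.
Qed.

(* [P] is onto the cube, but only the density of its image is needed. *)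
Theorem peano_curve (k : nat) (Hk : (1 <= k)%nat) :
  exists P : R -> nat -> R,
    (forall t, 0 <= t <= 1 -> in_cube k (P t)) /\
    (exists C, 0 < C /\ forall t t' i, 0 <= t <= 1 -> 0 <= t' <= 1 -> (i < k)%nat ->
       Rabs (P t i - P t' i) ^ k <= C * Rabs (t - t')) /\
    (forall y eps, in_cube k y -> 0 < eps -> exists t, 0 <= t <= 1 /\
       forall i, (i < k)%nat -> Rabs (P t i - y i) <= eps).
Proof.
  (* For [t] outside [[0,1]] no limit is guaranteed and the value may be arbitrary. *)
  pose (P := fun t i => epsilon (inhabits 0)
               (fun p => forall n, Rabs (p - peano_approx k n t i) <= osc k n i)).
  assert (HP : forall t i, 0 <= t <= 1 ->
                 forall n, Rabs (P t i - peano_approx k n t i) <= osc k n i).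
  { intros t i Ht. unfold P. apply epsilon_spec, peano_limit; auto. }
  exists P. split; [|split].
  - intros t Ht i _. split; apply Rnot_lt_le; intros Hlt.
    + destruct (osc_small k Hk i (- P t i)) as [n Hn]; [lra|].
      pose proof (HP t i Ht n). pose proof (peano_approx_cube k n t Ht i).
      unfold Rabs in *; destruct Rcase_abs; lra.
    + destruct (osc_small k Hk i (P t i - 1)) as [n Hn]; [lra|].
      pose proof (HP t i Ht n). pose proof (peano_approx_cube k n t Ht i).
      unfold Rabs in *; destruct Rcase_abs; lra.
  (* The 4 is 2 from the modulus of a stage plus 1 for each of the two limits; [3 ^ k] bounds the
     factor [3 ^ i] of [osc_pow]; the last 3 is lost in bracketing the distance between powers of
     [1/3]. *)
  - exists (4 ^ k * (3 ^ k * 3)). split.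
    { assert (0 < 4 ^ k) by (apply pow_lt; lra). assert (0 < 3 ^ k) by (apply pow_lt; lra). nra. }
    intros t t' i Ht Ht' Hi.
    destruct (Req_dec t t') as [<- | Hne].
    { rewrite !Rminus_diag, Rabs_R0, pow_i by lia. lra. }
    destruct (inv3_pow_bracket (Rabs (t - t'))) as [n [Hn1 Hn2]].
    { split; [apply Rabs_pos_lt; lra | apply Rabs_le; lra]. }
    assert (A : Rabs (P t i - P t' i) <= 4 * osc k n i).
    { pose proof (HP t i Ht n). pose proof (HP t' i Ht' n).
      pose proof (peano_approx_modulus k n t t' i Ht Ht' Hn2).
      unfold Rabs in *; repeat destruct Rcase_abs; lra. }
    eapply Rle_trans; [apply pow_incr; split; [apply Rabs_pos|exact A]|].
    rewrite Rpow_mult_distr, Rmult_assoc.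
    apply Rmult_le_compat_l; [apply pow_le; lra|].
    eapply Rle_trans; [apply osc_pow; auto|].
    rewrite Rmult_assoc. simpl in Hn1.
    assert (0 <= (/ 3) ^ n) by (apply pow_le; lra).
    apply Rmult_le_compat; try lra; [apply pow_le; lra|].
    apply Rle_pow; [lra|lia].
  - intros y eps Hy He.
    (* One stage has to serve all [k] coordinates; as [osc] does not increase with [n], the maximum
       of the individual stages works. *)
    assert (Hn : exists n, forall i, (i < k)%nat -> osc k n i < eps / 2).
    { assert (G : forall j, exists n, forall i, (i < j)%nat -> osc k n i < eps / 2).
      { induction j as [|j [n IH]]; [exists 0%nat; intros; lia|].
        destruct (osc_small k Hk j (eps / 2)) as [m Hm]; [lra|].
        assert (mono : forall p q i, (p <= q)%nat -> osc k q i <= osc k p i).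
        { intros p q i Hpq. induction Hpq; [lra|].
          eapply Rle_trans; [apply osc_antitone_S|auto]. }
        exists (max n m). intros i Hi. destruct (Nat.eq_dec i j) as [-> | ].
        - eapply Rle_lt_trans; [apply (mono m); lia|auto].
        - eapply Rle_lt_trans; [apply (mono n); lia|apply IH; lia]. }
      apply G. }
    destruct Hn as [n Hn].
    destruct (peano_approx_dense k Hk n y Hy) as (t & Ht & Hd).
    exists t. split; auto. intros i Hi.
    specialize (Hd i Hi). specialize (Hn i Hi). pose proof (HP t i Ht n).
    unfold Rabs in *; repeat destruct Rcase_abs; lra.
Qed.

(** * Volume of finite covers of the cube by boxes *)

Definition indicator (P : Prop) : R := if excluded_middle_informative P then 1 else 0.

Lemma indicator_ge0 P : 0 <= indicator P.
Proof. unfold indicator; destruct excluded_middle_informative; lra. Qed.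

Fixpoint nsum (q : nat) (a : nat -> R) : R :=
  match q with O => 0 | S q' => nsum q' a + a q' end.

(* Sum of [F] over the [Q^k] grid points whose first [k] coordinates are multiples of [1/Q]
   in [[0,1)]; the other coordinates are those of [u]. *)
Fixpoint grid_sum (Q k : nat) (F : (nat -> R) -> R) (u : nat -> R) : R :=
  match k with
  | O => F u
  | S k' => nsum Q (fun m => grid_sum Q k' F
                               (fun i => if Nat.eq_dec i k' then INR m / INR Q else u i))
  end.

Lemma nsum_le q a b : (forall m, (m < q)%nat -> a m <= b m) -> nsum q a <= nsum q b.
Proof. induction q as [|q IH]; simpl; intros H; [lra|]. apply Rplus_le_compat; auto. Qed.

Lemma nsum_plus q a b : nsum q (fun m => a m + b m) = nsum q a + nsum q b.
Proof. induction q as [|q IH]; simpl; [lra|]. rewrite IH; lra. Qed.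

Lemma nsum_scal q a c : nsum q (fun m => c * a m) = c * nsum q a.
Proof. induction q as [|q IH]; simpl; [lra|]. rewrite IH; lra. Qed.

Lemma nsum_const q c : nsum q (fun _ => c) = INR q * c.
Proof. induction q as [|q IH]; [simpl; lra|]. rewrite S_INR. simpl. rewrite IH. ring. Qed.

Lemma nsum_ext q a b : (forall m, a m = b m) -> nsum q a = nsum q b.
Proof. intros H; induction q as [|q IH]; simpl; [lra|]. now rewrite IH, H. Qed.

Lemma grid_sum_plus Q k F G u :
  grid_sum Q k (fun v => F v + G v) u = grid_sum Q k F u + grid_sum Q k G u.
Proof.
  revert u; induction k as [|k IH]; intros u; simpl; [lra|].
  rewrite <- nsum_plus. apply nsum_ext; intros; apply IH.
Qed.

Lemma grid_sum_zero Q k u : grid_sum Q k (fun _ => 0) u = 0.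
Proof.
  revert u; induction k as [|k IH]; intros u; simpl; [lra|].
  rewrite (nsum_ext Q _ (fun _ => 0)); [rewrite nsum_const; lra|]. intros; apply IH.
Qed.

Lemma grid_sum_nsum Q k N (F : nat -> (nat -> R) -> R) u :
  grid_sum Q k (fun v => nsum N (fun n => F n v)) u = nsum N (fun n => grid_sum Q k (F n) u).
Proof.
  induction N as [|N IH]; simpl; [apply grid_sum_zero|]. rewrite grid_sum_plus, IH. reflexivity.
Qed.

(** All [Q ^ k] grid points lie in the cube. The clause on the coordinates from [k] on lets the
    induction remember those already fixed by the outer sums. *)
Lemma grid_sum_ge Q k F u : (1 <= Q)%nat ->
  (forall v, (forall i, (i < k)%nat -> 0 <= v i <= 1) ->
             (forall i, (k <= i)%nat -> v i = u i) -> 1 <= F v) ->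
  INR Q ^ k <= grid_sum Q k F u.
Proof.
  intros HQ. revert u; induction k as [|k IH]; intros u H; simpl.
  - apply H; intros; [lia|auto].
  - rewrite <- nsum_const. apply nsum_le. intros m Hm. apply IH.
    intros v Hv Hu. apply H.
    + intros i Hi. destruct (Nat.eq_dec i k) as [-> | ]; [|apply Hv; lia].
      rewrite Hu by lia. destruct (Nat.eq_dec k k); [|lia].
      assert (0 < INR Q) by (apply lt_0_INR; lia).
      pose proof (pos_INR m). assert (INR m <= INR Q) by (apply le_INR; lia).
      split; [apply Rle_mult_inv_pos; auto|].
      apply (Rmult_le_reg_r (INR Q)); auto. field_simplify; lra.
    + intros i Hi. rewrite Hu by lia. destruct (Nat.eq_dec i k); [lia|auto].
Qed.

(** The truncation at [INR q] makes the bound inductive: counting the integer [q] moves the minimum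
    from [q] to [q + 1]. *)
Lemma count_interval q lo hi : nsum q (fun m => indicator (lo <= INR m <= hi)) <=
  Rmax 0 (Rmin (INR q) (hi + 1) - lo).
Proof.
  induction q as [|q IH]; [simpl; apply Rmax_l|].
  rewrite S_INR. simpl. unfold indicator at 2.
  destruct excluded_middle_informative as [H | H].
  - eapply Rle_trans; [apply Rplus_le_compat_r, IH|].
    unfold Rmax, Rmin; repeat destruct Rle_dec; lra.
  - rewrite Rplus_0_r. eapply Rle_trans; [apply IH|].
    unfold Rmax, Rmin; repeat destruct Rle_dec; lra.
Qed.

(** An interval of length [2 * a] holds at most [2 * a * INR Q + 1] multiples of [1/Q], and the
    fineness of the grid absorbs the 1. *)
Lemma count_grid_points Q p a : (1 <= Q)%nat -> 1 <= a * INR Q ->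
  nsum Q (fun m => indicator (Rabs (INR m / INR Q - p) <= a)) <= 3 * a * INR Q.
Proof.
  intros HQ Ha. assert (0 < INR Q) by (apply lt_0_INR; lia).
  set (lo := (p - a) * INR Q). set (hi := (p + a) * INR Q).
  eapply Rle_trans; [apply (nsum_le Q _ (fun m => indicator (lo <= INR m <= hi)))|].
  - intros m _. unfold indicator at 1. destruct excluded_middle_informative as [Hm|]; [|apply indicator_ge0].
    unfold indicator. destruct excluded_middle_informative as [|C]; [lra|].
    exfalso; apply C. unfold lo, hi.
    replace (INR m) with (INR m / INR Q * INR Q) by (field; lra).
    unfold Rabs in Hm; destruct Rcase_abs; split; nra.
  - eapply Rle_trans; [apply count_interval|].
    unfold Rmax, Rmin, lo, hi; repeat destruct Rle_dec; nra.
Qed.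

Lemma indicator_box_S p a k v :
  indicator (forall i, (i < S k)%nat -> Rabs (v i - p i) <= a) =
  indicator (Rabs (v k - p k) <= a) * indicator (forall i, (i < k)%nat -> Rabs (v i - p i) <= a).
Proof.
  unfold indicator. repeat destruct excluded_middle_informative; try lra; exfalso.
  - apply n; intros; auto.
  - apply n; auto.
  - apply n; auto.
  - apply n. intros i Hi. destruct (Nat.eq_dec i k) as [-> | ]; auto. apply r0; lia.
Qed.

Lemma grid_sum_scal Q k F c u : grid_sum Q k (fun v => c * F v) u = c * grid_sum Q k F u.
Proof.
  revert u; induction k as [|k IH]; intros u; simpl; [lra|].
  rewrite <- nsum_scal. apply nsum_ext; intros; apply IH.
Qed.

Lemma grid_sum_ext Q k F G u :
  (forall v, (forall i, (k <= i)%nat -> v i = u i) -> F v = G v) ->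
  grid_sum Q k F u = grid_sum Q k G u.
Proof.
  revert u; induction k as [|k IH]; intros u H; simpl; [apply H; auto|].
  apply nsum_ext. intros m. apply IH. intros v Hv. apply H.
  intros i Hi. rewrite Hv by lia. destruct (Nat.eq_dec i k); [lia|auto].
Qed.

Lemma grid_sum_box Q k p a u : (1 <= Q)%nat -> 1 <= a * INR Q ->
  grid_sum Q k (fun v => indicator (forall i, (i < k)%nat -> Rabs (v i - p i) <= a)) u
    <= (3 * a * INR Q) ^ k.
Proof.
  intros HQ Ha. revert u; induction k as [|k IH]; intros u.
  - simpl. unfold indicator; destruct excluded_middle_informative; lra.
  - simpl.
    eapply Rle_trans; [|apply Rmult_le_compat_r;
                         [apply pow_le; nra | apply (count_grid_points Q (p k) a HQ Ha)]].
    rewrite (Rmult_comm (nsum _ _)), <- nsum_scal. apply nsum_le. intros m _.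
    set (w := fun i => if Nat.eq_dec i k then INR m / INR Q else u i).
    (* On this slice coordinate [k] is constant, so its factor of the box indicator leaves the inner
       sum. *)
    rewrite (grid_sum_ext Q k _ (fun v => indicator (Rabs (INR m / INR Q - p k) <= a) *
        indicator (forall i, (i < k)%nat -> Rabs (v i - p i) <= a))).
    + rewrite grid_sum_scal, Rmult_comm. apply Rmult_le_compat_r; [apply indicator_ge0|apply IH].
    + intros v Hv. rewrite indicator_box_S, (Hv k) by lia.
      unfold w. destruct (Nat.eq_dec k k); [auto|lia].
Qed.

Lemma nsum_pos_term q a n : (n < q)%nat -> (forall m, 0 <= a m) -> a n <= nsum q a.
Proof.
  intros Hn Ha. induction q as [|q IH]; [lia|]. simpl.
  destruct (Nat.eq_dec n q) as [-> | ].
  - assert (0 <= nsum q a); [|specialize (Ha q); lra].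
    clear -Ha; induction q as [|q IH]; simpl; [lra|]. specialize (Ha q); lra.
  - specialize (IH ltac:(lia)). specialize (Ha q); lra.
Qed.

Lemma exists_fine_grid N (a : nat -> R) : (forall n, 0 < a n) ->
  exists Q, (1 <= Q)%nat /\ forall n, (n < N)%nat -> 1 <= a n * INR Q.
Proof.
  intros Ha. induction N as [|N (Q & HQ & IH)]; [exists 1%nat; split; [auto|intros; lia]|].
  destruct (INR_unbounded (/ a N)) as [q Hq].
  exists (max Q q). split; [lia|]. intros n Hn.
  assert (INR Q <= INR (max Q q)) by (apply le_INR; lia).
  assert (INR q <= INR (max Q q)) by (apply le_INR; lia).
  pose proof (Ha n) as Hp.
  destruct (Nat.eq_dec n N) as [-> | ].
  - apply (Rmult_gt_compat_l (a N)) in Hq; auto. rewrite Rinv_r in Hq by lra. nra.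
  - specialize (IH n ltac:(lia)). nra.
Qed.

(** Double counting on a grid fine enough for all [N] boxes: each of the [Q ^ k] points is in some
    box, and a box holds at most [(3 * a n * Q) ^ k] of them. *)
Theorem cube_cover_volume k N (p : nat -> nat -> R) (a : nat -> R) :
  (forall n, 0 < a n) ->
  (forall y, in_cube k y ->
     exists n, (n < N)%nat /\ forall i, (i < k)%nat -> Rabs (y i - p n i) <= a n) ->
  1 <= nsum N (fun n => (3 * a n) ^ k).
Proof.
  intros Ha Hcov. destruct (exists_fine_grid N a Ha) as (Q & HQ & HaQ).
  assert (HQ0 : 0 < INR Q ^ k) by (apply pow_lt, lt_0_INR; lia).
  apply (Rmult_le_reg_l (INR Q ^ k)); auto. rewrite Rmult_1_r, <- nsum_scal.
  eapply Rle_trans; [apply (grid_sum_ge Q k (fun v => nsum N (fun n =>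
     indicator (forall i, (i < k)%nat -> Rabs (v i - p n i) <= a n))) (fun _ => 0) HQ)|].
  - intros v Hv _. destruct (Hcov v Hv) as (n & Hn & Hb).
    eapply Rle_trans; [|apply nsum_pos_term; [exact Hn|intros; apply indicator_ge0]].
    unfold indicator; destruct excluded_middle_informative; [lra|contradiction].
  - rewrite grid_sum_nsum. apply nsum_le. intros n Hn.
    eapply Rle_trans; [apply grid_sum_box; auto|].
    rewrite <- Rpow_mult_distr. apply Req_le. f_equal. ring.
Qed.

(** * Compact ultrametric spaces *)

Lemma pow_lt_mono_l k a b : (1 <= k)%nat -> 0 <= a < b -> a ^ k < b ^ k.
Proof.
  intros Hk Hab. induction Hk as [|k Hk IH]; [simpl; lra|].
  simpl. assert (0 <= a ^ k) by (apply pow_le; lra). nra.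
Qed.

Lemma pow_le_reg_l k a b : (1 <= k)%nat -> 0 <= b -> a ^ k <= b ^ k -> a <= b.
Proof.
  intros Hk Hb H. apply Rnot_lt_le. intros Hlt.
  pose proof (pow_lt_mono_l k b a Hk (conj Hb Hlt)). lra.
Qed.

Lemma pow_le_self k a : (1 <= k)%nat -> 0 <= a <= 1 -> a ^ k <= a.
Proof.
  intros Hk Ha. induction Hk as [|k Hk IH]; [simpl; lra|].
  simpl. assert (0 <= a ^ k) by (apply pow_le; lra). nra.
Qed.

Lemma list_nat_bound (l : list nat) : exists N, forall n, In n l -> (n < N)%nat.
Proof.
  induction l as [|a l [N IH]]; [exists 0%nat; intros n []|].
  exists (S (max a N)). intros n [<- | Hn]; [lia|]. specialize (IH n Hn). lia.
Qed.

Lemma sqsum_ge0 k u v : 0 <= sqsum k u v.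
Proof. induction k as [|k IH]; simpl; [lra|]. pose proof (pow2_ge_0 (u k - v k)). simpl in *; lra. Qed.

Lemma coord_le_eucl_dist k u v i : (i < k)%nat -> Rabs (u i - v i) <= eucl_dist k u v.
Proof.
  intros Hi. unfold eucl_dist. rewrite <- sqrt_Rsqr_abs. apply sqrt_le_1_alt.
  induction k as [|k IH]; [lia|]. simpl. unfold Rsqr in *.
  destruct (Nat.eq_dec i k) as [-> | ].
  - pose proof (sqsum_ge0 k u v). lra.
  - specialize (IH ltac:(lia)). pose proof (pow2_ge_0 (u k - v k)). simpl in *; lra.
Qed.

(** The constant [INR k] instead of its square root is crude but sufficient: [k <= k ^ 2]. *)
Lemma eucl_dist_le k u v D : 0 <= D -> (forall i, (i < k)%nat -> Rabs (u i - v i) <= D) ->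
  eucl_dist k u v <= INR k * D.
Proof.
  intros HD H. pose proof (pos_INR k).
  rewrite <- (sqrt_pow2 (INR k * D)) by nra. apply sqrt_le_1_alt.
  assert (G : sqsum k u v <= INR k * D ^ 2).
  { clear -H. induction k as [|k IH]; [simpl; lra|]. rewrite S_INR. simpl sqsum.
    specialize (IH (fun i Hi => H i ltac:(lia))). specialize (H k ltac:(lia)).
    assert ((u k - v k) ^ 2 <= D ^ 2).
    { rewrite <- (pow2_abs (u k - v k)). apply pow_incr. split; [apply Rabs_pos|auto]. }
    lra. }
  eapply Rle_trans; [apply G|]. rewrite Rpow_mult_distr. apply Rmult_le_compat_r; [apply pow2_ge_0|].
  destruct k; [simpl; lra|]. rewrite S_INR in *. pose proof (pos_INR k).
  simpl pow. nra.
Qed.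

(** Applied later to an order and to its reverse, so that it supplies minima as well. *)
Lemma finite_max {X : Type} (le : X -> X -> Prop) (Q : X -> Prop) (l : list X) :
  (forall x y, le x y \/ le y x) -> (forall x y z, le x y -> le y z -> le x z) ->
  (forall x, In x l -> ~ Q x) \/
  (exists m, In m l /\ Q m /\ forall x, In x l -> Q x -> le x m).
Proof.
  intros Htot Htr. assert (Hrefl : forall x, le x x) by (intros x; destruct (Htot x x); auto).
  induction l as [|a l IH]; [left; intros x []|].
  destruct (classic (Q a)) as [Ha | Ha].
  - right. destruct IH as [IH | (m & Hm & Qm & IH)].
    + exists a. split; [now left|]. split; [auto|].
      intros x [<- | Hx] Qx; [auto|]. destruct (IH x Hx Qx).
    + destruct (Htot a m) as [H | H].
      * exists m. split; [now right|]. split; [auto|]. intros x [<- | Hx] Qx; auto.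
      * exists a. split; [now left|]. split; [auto|]. intros x [<- | Hx] Qx; auto.
        apply Htr with m; auto.
  - destruct IH as [IH | (m & Hm & Qm & IH)].
    + left. intros x [<- | Hx]; auto.
    + right. exists m. split; [now right|]. split; [auto|].
      intros x [<- | Hx] Qx; [contradiction|auto].
Qed.

Section Ultrametric.
Context {X : Type} (d : X -> X -> R) (Hd : is_ultrametric d) (Hc : compact_space d).

Lemma dist_ge0 x y : 0 <= d x y.
Proof. apply Hd. Qed.

Lemma dist_refl x : d x x = 0.
Proof. now apply Hd. Qed.

Lemma dist_sym x y : d x y = d y x.
Proof. apply Hd. Qed.

Lemma dist_eq0 x y : d x y = 0 -> x = y.
Proof. apply Hd. Qed.

(** The main working form of the ultrametric inequality: the diameter of a ball does not exceed its
    radius. *)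
Lemma dist_common x y z r : d z x <= r -> d z y <= r -> d x y <= r.
Proof.
  intros H1 H2. destruct Hd as (_ & _ & _ & H).
  eapply Rle_trans; [apply (H x y z)|]. rewrite (dist_sym x z), (dist_sym y z).
  now apply Rmax_lub.
Qed.

Lemma dist_common_lt x y z r : d z x < r -> d z y < r -> d x y < r.
Proof.
  intros H1 H2. destruct Hd as (_ & _ & _ & H).
  eapply Rle_lt_trans; [apply (H x y z)|]. rewrite (dist_sym x z), (dist_sym y z).
  now apply Rmax_lub_lt.
Qed.

Lemma finite_net r : 0 < r -> exists l, forall x, exists c, In c l /\ d c x < r.
Proof.
  intros Hr. apply (Hc X (fun c x => d c x < r)).
  - intros c x Hx. exists r. split; [auto|]. intros y Hy.
    apply (dist_common_lt c y x); auto. now rewrite dist_sym.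
  - intros x. exists x. now rewrite dist_refl.
Qed.

Lemma dist_bounded : exists M, 0 < M /\ forall x y, d x y < M.
Proof.
  destruct (finite_net 1) as [l Hl]; [lra|].
  assert (H : forall c, exists M, 1 < M /\ forall x, In x l -> d c x < M).
  { intros c. clear Hl. induction l as [|a l (M & HM & IH)].
    - exists 2. split; [lra|]. intros x [].
    - exists (Rmax M (d c a + 1)). split; [eapply Rlt_le_trans; [apply HM|apply Rmax_l]|].
      intros x [<- | Hx].
      + eapply Rlt_le_trans; [|apply Rmax_r]; lra.
      + eapply Rlt_le_trans; [apply IH; auto|apply Rmax_l]. }
  destruct l as [|a l].
  { exists 1. split; [lra|]. intros x. destruct (Hl x) as (c & [] & _). }
  destruct (H a) as (M & HM & Ha). exists M. split; [lra|]. intros x y.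
  assert (G : forall z, d a z < M).
  { intros z. destruct (Hl z) as (c & Hcl & Hcz). specialize (Ha c Hcl).
    apply (dist_common_lt a z c); [now rewrite dist_sym|lra]. }
  apply (dist_common_lt x y a); auto.
Qed.

Lemma diam_spec (A : X -> Prop) :
  ((forall x, ~ A x) /\ diam d A = 0) \/
  is_lub (fun v => exists x y, A x /\ A y /\ v = d x y) (diam d A).
Proof.
  unfold diam. apply epsilon_spec.
  destruct (classic (exists x, A x)) as [[x Hx] | Hn].
  - destruct dist_bounded as (M & _ & HM).
    destruct (completeness (fun v => exists x y, A x /\ A y /\ v = d x y)) as [s Hs].
    + exists M. intros v (y & z & _ & _ & ->). left; auto.
    + exists (d x x), x, x; auto.
    + exists s; auto.
  - exists 0. left. split; auto. intros x Hx; apply Hn; now exists x.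
Qed.

Lemma dist_le_diam (A : X -> Prop) x y : A x -> A y -> d x y <= diam d A.
Proof.
  intros Hx Hy. destruct (diam_spec A) as [[H _] | [H _]]; [destruct (H x Hx)|].
  apply H. now exists x, y.
Qed.

Lemma diam_le (A : X -> Prop) r : 0 <= r -> (forall x y, A x -> A y -> d x y <= r) ->
  diam d A <= r.
Proof.
  intros Hr H. destruct (diam_spec A) as [[_ ->] | [_ G]]; [auto|].
  apply G. intros v (x & y & Hx & Hy & ->). auto.
Qed.

Lemma diam_ge0 (A : X -> Prop) : 0 <= diam d A.
Proof.
  destruct (classic (exists x, A x)) as [[x Hx] | Hn].
  - rewrite <- (dist_refl x). now apply dist_le_diam.
  - destruct (diam_spec A) as [[_ ->] | [_ G]]; [lra|].
    (* Every real is an upper bound of the empty set, so a least one cannot exist. *)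
    exfalso. assert (diam d A <= diam d A - 1); [|lra].
    apply G. intros v (x & _ & Hx & _). exfalso; apply Hn; now exists x.
Qed.

(** * Maps onto the cube force positive measure *)

Lemma geometric_nsum N : nsum N (fun n => (/ 2) ^ S n) <= 1.
Proof.
  enough (nsum N (fun n => (/ 2) ^ S n) = 1 - (/ 2) ^ N) as ->.
  { assert (0 <= (/ 2) ^ N) by (apply pow_le; lra). lra. }
  induction N as [|N IH]; [simpl; lra|]. change (nsum N (fun n => (/ 2) ^ S n) + (/ 2) ^ S N = 1 - (/ 2) ^ S N).
  rewrite IH. simpl. lra.
Qed.

Lemma nsum_sum_f_R0 a N : nsum (S N) a = sum_f_R0 a N.
Proof. induction N as [|N IH]; [simpl; lra|]. simpl in *. now rewrite IH. Qed.

(* Closed balls of positive radius are open, so after fattening the sets of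
   diameter zero the cover can be made finite. *)
Lemma finite_ball_cover k (E : nat -> X -> Prop) eta : (1 <= k)%nat -> 0 < eta <= 1 ->
  (forall x, exists n, E n x) ->
  exists N (s : nat -> R) (c : nat -> X -> Prop),
    (forall n, 0 < s n) /\
    (forall x, exists n, (n < N)%nat /\ c n x) /\
    (forall n x y, c n x -> c n y -> d x y <= s n) /\
    nsum N (fun n => s n ^ k) <= nsum N (fun n => diam d (E n) ^ k) + eta.
Proof.
  intros Hk He Hcov.
  (* The replacement radii add up to at most [eta], and so do their [k]-th powers because each
     radius is at most 1. *)
  set (s := fun n => if Rlt_dec 0 (diam d (E n)) then diam d (E n) else eta * (/ 2) ^ S n).
  set (U := fun n x => exists y, E n y /\ d y x <= s n).
  assert (Hs : forall n, 0 < s n).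
  { intros n. unfold s. destruct Rlt_dec; auto.
    assert (0 < (/ 2) ^ S n) by (apply pow_lt; lra). nra. }
  assert (Hds : forall n, diam d (E n) <= s n).
  { intros n. specialize (Hs n). unfold s in *. destruct Rlt_dec; lra. }
  destruct (Hc nat U) as [l Hl].
  - intros n x (y & Hy & Hyx). exists (s n). split; [auto|]. intros z Hz.
    exists y. split; auto. apply (dist_common y z x); [now rewrite dist_sym|lra].
  - intros x. destruct (Hcov x) as [n Hn]. exists n, x. split; auto.
    rewrite dist_refl. left; auto.
  - destruct (list_nat_bound l) as [N HN].
    exists N, s, U. split; [auto|]. split; [|split].
    + intros x. destruct (Hl x) as (n & Hn & Hx). exists n; auto.
    + intros n x y (x' & Hx' & Hx) (y' & Hy' & Hy).
      assert (d x' y' <= s n) by (eapply Rle_trans; [apply dist_le_diam; eauto|apply Hds]).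
      apply (dist_common x y x'); auto.
      apply (dist_common x' y y'); auto. now rewrite dist_sym.
    + apply Rle_trans with (nsum N (fun n => diam d (E n) ^ k + eta * (/ 2) ^ S n)).
      * apply nsum_le. intros n _. unfold s. pose proof (diam_ge0 (E n)).
        assert (0 < (/ 2) ^ S n <= 1).
        { split; [apply pow_lt; lra|]. rewrite <- (pow1 (S n)). apply pow_incr; lra. }
        destruct Rlt_dec.
        -- nra.
        -- pose proof (pow_le (diam d (E n)) k (diam_ge0 _)).
           pose proof (pow_le_self k (eta * (/ 2) ^ S n) Hk ltac:(nra)). lra.
      * rewrite nsum_plus, nsum_scal. pose proof (geometric_nsum N). nra.
Qed.

Theorem lipschitz_onto_cube_measure_pos k f : (1 <= k)%nat ->
  lipschitz d k f -> onto_cube k f -> hausdorff_measure_pos d k.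
Proof.
  intros Hk (L & HL & Hlip) (_ & Honto).
  (* The 3 comes from [cube_cover_volume]; [L + 1] in place of [L] keeps the boxes nondegenerate and
     gives [1 <= K]. *)
  set (K := (3 * (L + 1)) ^ k).
  assert (HK : 1 <= K) by (apply pow_R1_Rle; lra).
  assert (HiK : 0 < / K <= 1).
  { split; [apply Rinv_0_lt_compat; lra|]. rewrite <- Rinv_1. apply Rinv_le_contravar; lra. }
  (* The finite cover costs at least [/ K]; half of that is spent on [eta] in the fattening. *)
  exists 1, (/ K / 2). split; [lra|]. split; [lra|].
  intros E Hcov _ c' Hc'. apply NNPP. intros Hno.
  destruct (finite_ball_cover k E (/ K / 2) Hk ltac:(lra) Hcov) as (N & s & U & Hs & HU & HUd & Hsum).
  assert (Hlow : 1 <= K * nsum N (fun n => s n ^ k)).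
  { destruct (Honto (fun _ => 0)) as [x0 _]; [intros i Hi; lra|].
    set (c := fun n => epsilon (inhabits x0) (U n)).
    rewrite <- nsum_scal.
    rewrite (nsum_ext N _ (fun n => (3 * ((L + 1) * s n)) ^ k)).
    2:{ intros n. unfold K. rewrite <- Rpow_mult_distr. f_equal. ring. }
    apply (cube_cover_volume k N (fun n => f (c n))).
    - intros n. specialize (Hs n). nra.
    - intros y Hy. destruct (Honto y Hy) as [x Hx]. destruct (HU x) as (n & Hn & Hxn).
      exists n. split; auto. intros i Hi. rewrite <- Hx by auto.
      assert (Hcn : U n (c n)) by (apply epsilon_spec; now exists x).
      eapply Rle_trans; [apply coord_le_eucl_dist; eauto|].
      eapply Rle_trans; [apply Hlip|].
      specialize (HUd n x (c n) Hxn Hcn). specialize (Hs n). pose proof (dist_ge0 x (c n)). nra. }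
  assert (Hup : nsum N (fun n => diam d (E n) ^ k) < / K / 2).
  { destruct N as [|N]; [simpl; lra|]. rewrite nsum_sum_f_R0.
    apply Rnot_le_lt. intros H. apply Hno. exists N. lra. }
  assert (K * nsum N (fun n => s n ^ k) < K * / K) by (apply Rmult_lt_compat_l; lra).
  rewrite Rinv_r in H; lra.
Qed.

(** * The content of initial segments *)

Definition ball_cover (A : X -> Prop) (l : list (X * R)) : Prop :=
  (forall b, In b l -> 0 <= snd b) /\
  (forall x, A x -> exists b, In b l /\ d (fst b) x <= snd b).

Fixpoint cost (k : nat) (l : list (X * R)) : R :=
  match l with nil => 0 | b :: l' => snd b ^ k + cost k l' end.

(** The Hausdorff content, with no bound on the scale, taken over finite covers by closed balls and
    weighted by radii; the two clauses characterise the infimum. *)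
Definition content (k : nat) (A : X -> Prop) : R :=
  epsilon (inhabits 0) (fun h =>
    (forall l, ball_cover A l -> h <= cost k l) /\
    (forall eps, 0 < eps -> exists l, ball_cover A l /\ cost k l < h + eps)).

Lemma cost_ge0 k l : (forall b, In b l -> 0 <= snd b) -> 0 <= cost k l.
Proof.
  induction l as [|b l IH]; simpl; intros H; [lra|].
  assert (0 <= snd b ^ k) by (apply pow_le, H; now left). specialize (IH ltac:(auto)). lra.
Qed.

Lemma cost_app k l l' : cost k (l ++ l') = cost k l + cost k l'.
Proof. induction l as [|b l IH]; simpl; [lra|]. rewrite IH; lra. Qed.

Lemma cost_In k l b : (forall b, In b l -> 0 <= snd b) -> In b l -> snd b ^ k <= cost k l.
Proof.
  induction l as [|a l IH]; simpl; intros H []; subst.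
  - pose proof (cost_ge0 k l ltac:(auto)). lra.
  - specialize (IH ltac:(auto) ltac:(auto)).
    assert (0 <= snd a ^ k) by (apply pow_le, H; now left). lra.
Qed.

Lemma content_spec k A :
  (forall l, ball_cover A l -> content k A <= cost k l) /\
  (forall eps, 0 < eps -> exists l, ball_cover A l /\ cost k l < content k A + eps).
Proof.
  unfold content. apply epsilon_spec.
  (* The infimum is obtained as a negated supremum; a finite net of radius 1 shows that some cover
     exists. *)
  destruct (completeness (fun v => exists l, ball_cover A l /\ v = - cost k l)) as [s [Hub Hlub]].
  - exists 0. intros v (l & [Hl _] & ->). pose proof (cost_ge0 k l Hl). lra.
  - destruct (finite_net 1) as [l Hl]; [lra|].
    exists (- cost k (map (fun c => (c, 1)) l)), (map (fun c => (c, 1)) l). split; auto. split.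
    + intros b Hb. apply in_map_iff in Hb as (c & <- & _). simpl; lra.
    + intros x _. destruct (Hl x) as (c & Hcl & Hx). exists (c, 1). split; [|simpl; lra].
      apply in_map_iff. now exists c.
  - exists (- s). split.
    + intros l Hl. assert (- cost k l <= s); [|lra]. apply Hub. now exists l.
    + intros eps He. apply NNPP. intros Hn.
      assert (s <= s - eps); [|lra]. apply Hlub. intros v (l & Hl & ->).
      apply Rnot_lt_le. intros Hlt. apply Hn. exists l. split; auto. lra.
Qed.

Lemma content_ge0 k A : 0 <= content k A.
Proof.
  apply Rnot_lt_le. intros H. destruct (content_spec k A) as [_ G].
  destruct (G (- content k A)) as (l & [Hl _] & Hlt); [lra|].
  pose proof (cost_ge0 k l Hl). lra.
Qed.

Lemma content_union_le k (A B C : X -> Prop) :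
  (forall x, A x -> B x \/ C x) -> content k A <= content k B + content k C.
Proof.
  intros H. apply Rnot_lt_le. intros Hlt.
  set (eps := (content k A - content k B - content k C) / 2).
  assert (He : 0 < eps) by (unfold eps; lra).
  destruct (content_spec k B) as [_ GB]. destruct (GB eps He) as (l & [Hl Hlc] & Hlk).
  destruct (content_spec k C) as [_ GC]. destruct (GC eps He) as (m & [Hm Hmc] & Hmk).
  destruct (content_spec k A) as [GA _].
  assert (content k A <= cost k (l ++ m)).
  { apply GA. split.
    - intros b Hb. apply in_app_or in Hb as []; auto.
    - intros x Hx. destruct (H x Hx) as [Hx' | Hx'];
        [destruct (Hlc x Hx') as (b & Hb & Hbx) | destruct (Hmc x Hx') as (b & Hb & Hbx)];
        exists b; auto using in_or_app. }
  rewrite cost_app in *. unfold eps in *; lra.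
Qed.

Lemma content_ball_le k c r (A : X -> Prop) : 0 <= r -> (forall x, A x -> d c x <= r) ->
  content k A <= r ^ k.
Proof.
  intros Hr H. destruct (content_spec k A) as [G _].
  replace (r ^ k) with (cost k ((c, r) :: nil)) by (simpl; lra). apply G. split.
  - intros b [<- | []]; auto.
  - intros x Hx. exists (c, r). split; [now left|auto].
Qed.

Lemma content_empty k (A : X -> Prop) : (forall x, ~ A x) -> content k A = 0.
Proof.
  intros H. apply Rle_antisym; [|apply content_ge0].
  destruct (content_spec k A) as [G _]. apply (G nil). split.
  - intros b [].
  - intros x Hx; destruct (H x Hx).
Qed.

Lemma content_mono k (A B : X -> Prop) : (forall x, A x -> B x) -> content k A <= content k B.
Proof.
  intros H. rewrite <- (Rplus_0_r (content k B)), <- (content_empty k (fun _ => False)) by auto.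
  apply content_union_le; auto.
Qed.

Lemma sum_nth_cost_le k l N : (forall b, In b l -> 0 <= snd b) ->
  sum_f_R0 (fun n => match nth_error l n with Some b => snd b ^ k | None => 0 end) N <= cost k l.
Proof.
  revert N; induction l as [|a l IH]; intros N H; simpl cost.
  - rewrite (sum_eq _ (fun _ => 0)); [rewrite sum_cte; lra|]. intros [|n] _; auto.
  - assert (0 <= cost k l) by (apply cost_ge0; intros; apply H; now right).
    destruct N as [|N]; [simpl; lra|].
    rewrite decomp_sum by lia. simpl. apply Rplus_le_compat_l, IH. intros; apply H; now right.
Qed.

(** A cover cheaper than [delta ^ k] has all radii below [delta], so a cover of small cost is
    automatically fine and the bound at scale [delta] applies to it. *)
Lemma content_pos k : (1 <= k)%nat -> hausdorff_measure_pos d k -> 0 < content k (fun _ => True).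
Proof.
  intros Hk (delta & c & Hdelta & Hc0 & HE). apply Rnot_le_lt. intros Hle.
  assert (Hdk : 0 < delta ^ k) by (apply pow_lt; auto).
  assert (Hmin : 0 < Rmin c (delta ^ k)) by (apply Rmin_glb_lt; auto).
  destruct (content_spec k (fun _ => True)) as [_ G].
  destruct (G _ Hmin) as (l & [Hl Hcov] & Hlt).
  assert (Hlc : cost k l < c) by (pose proof (Rmin_l c (delta ^ k)); lra).
  assert (Hld : cost k l < delta ^ k) by (pose proof (Rmin_r c (delta ^ k)); lra).
  (* The finite cover is padded with empty sets, whose diameter is 0. *)
  set (E := fun n x => match nth_error l n with Some b => d (fst b) x <= snd b | None => False end).
  assert (Hdiam : forall n, diam d (E n) <= match nth_error l n with Some b => snd b | None => 0 end).
  { intros n. unfold E. destruct (nth_error l n) as [b|] eqn:Hb.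
    - apply diam_le; [apply Hl; eapply nth_error_In; eauto|].
      intros x y. apply dist_common.
    - apply diam_le; [lra|]. intros x y []. }
  destruct (HE E) with (c' := cost k l) as [N HN]; auto.
  - intros x. destruct (Hcov x I) as (b & Hb & Hbx).
    apply In_nth_error in Hb as [n Hn]. exists n. unfold E. now rewrite Hn.
  - intros n. eapply Rle_trans; [apply Hdiam|].
    destruct (nth_error l n) as [b|] eqn:Hb; [|lra].
    apply (pow_le_reg_l k); auto; [lra|].
    apply nth_error_In in Hb. pose proof (cost_In k l b Hl Hb). lra.
  - apply (Rlt_irrefl (cost k l)). eapply Rlt_le_trans; [apply HN|].
    eapply Rle_trans; [apply sum_Rle|apply (sum_nth_cost_le k l N Hl)].
    intros n _. cbv beta. specialize (Hdiam n). pose proof (diam_ge0 (E n)).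
    destruct (nth_error l n) as [b|].
    + apply pow_incr; auto.
    + replace (diam d (E n)) with 0 by lra. rewrite pow_i by lia. lra.
Qed.

(** * A linear order with almost convex balls *)

Lemma ball_index r : 0 < r -> exists e : X -> nat, forall x y, e x = e y <-> d x y < r.
Proof.
  intros Hr. destruct (finite_net r Hr) as [l Hl].
  (* Being closer than [r] is an equivalence relation here, so the first net centre within [r] of a
     point depends only on its class and determines it. *)
  set (P := fun x j => exists c, nth_error l j = Some c /\ d c x < r).
  set (least := fun x j => P x j /\ forall i, (i < j)%nat -> ~ P x i).
  assert (Hleast : forall x, exists j, least x j).
  { intros x. destruct (Hl x) as (c & Hcl & Hcx). apply In_nth_error in Hcl as [j Hj].
    assert (Hp : P x j) by (now exists c). clear Hj Hcx.
    induction j as [j IH] using (well_founded_induction Wf_nat.lt_wf).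
    destruct (classic (exists i, (i < j)%nat /\ P x i)) as [(i & Hi & Hpi) | Hn]; [eauto|].
    exists j. split; auto. intros i Hi Hpi. apply Hn. eauto. }
  exists (fun x => epsilon (inhabits 0%nat) (least x)).
  intros x y. pose proof (epsilon_spec (inhabits 0%nat) (least x) (Hleast x)) as [Hx Hx'].
  pose proof (epsilon_spec (inhabits 0%nat) (least y) (Hleast y)) as [Hy Hy'].
  set (i := epsilon _ (least x)) in *. set (j := epsilon _ (least y)) in *.
  assert (T : forall a b n, d a b < r -> P a n -> P b n).
  { intros a b n Hab (c & Hn & Hca). exists c. split; auto.
    apply (dist_common_lt c b a); auto. now rewrite dist_sym. }
  split.
  - intros Hij. rewrite Hij in Hx. destruct Hx as (c & Hcj & Hcx), Hy as (c' & Hcj' & Hcy).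
    rewrite Hcj in Hcj'. injection Hcj' as <-. now apply (dist_common_lt x y c).
  - intros Hxy. destruct (Nat.lt_trichotomy i j) as [Hlt | [Heq | Hlt]]; auto; exfalso.
    + apply (Hy' i Hlt). now apply (T x).
    + apply (Hx' j Hlt). apply (T y); auto. now rewrite dist_sym.
Qed.

(* The lexicographic order of the sequences of ball indices at scales [M / 2^n]. *)
Lemma convex_order : exists le : X -> X -> Prop,
  (forall x y, le x y \/ le y x) /\
  (forall x y z, le x y -> le y z -> le x z) /\
  (forall x y z, le x z -> le z y -> d x z <= 2 * d x y).
Proof.
  destruct dist_bounded as (M & HM & Hb).
  assert (Hr : forall n, 0 < M * (/ 2) ^ n) by (intros n; apply Rmult_lt_0_compat; auto; apply pow_lt; lra).
  set (e := fun n => epsilon (inhabits (fun _ : X => 0%nat))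
                       (fun e => forall x y, e x = e y <-> d x y < M * (/ 2) ^ n)).
  assert (He : forall n x y, e n x = e n y <-> d x y < M * (/ 2) ^ n).
  { intros n. unfold e. apply epsilon_spec, ball_index, Hr. }
  clearbody e.
  set (lt := fun x y => exists n, (forall m, (m < n)%nat -> e m x = e m y) /\ (e n x < e n y)%nat).
  exists (fun x y => x = y \/ lt x y). split; [|split].
  - intros x y. destruct (classic (x = y)) as [|Hne]; [auto|].
    assert (Hn : exists n, e n x <> e n y).
    { assert (Hp : 0 < d x y).
      { destruct (dist_ge0 x y) as [|H]; auto. exfalso; apply Hne, dist_eq0; auto. }
      destruct (pow_lt_1_zero (/ 2)) with (y := d x y / M) as [n Hn].
      - rewrite Rabs_right; lra.
      - now apply Rdiv_lt_0_compat.
      - exists n. intros Heq. apply He in Heq. specialize (Hn n (le_n _)).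
        rewrite Rabs_right in Hn by (apply Rle_ge, pow_le; lra).
        apply (Rmult_lt_compat_l M) in Hn; auto.
        replace (M * (d x y / M)) with (d x y) in Hn by (field; lra). lra. }
    destruct Hn as [n Hn].
    (* Strong induction finds the first scale at which the indices differ; that scale decides the
       comparison. *)
    induction n as [n IH] using (well_founded_induction Wf_nat.lt_wf).
    destruct (classic (exists m, (m < n)%nat /\ e m x <> e m y)) as [(m & Hm & Hmx) | Hno]; [eauto|].
    assert (Hagree : forall m, (m < n)%nat -> e m x = e m y).
    { intros m Hm. apply NNPP. intros H. apply Hno. eauto. }
    destruct (Nat.lt_trichotomy (e n x) (e n y)) as [H | [H | H]]; [|contradiction|].
    + left; right. exists n; auto.
    + right; right. exists n. split; auto. intros; symmetry; auto.
  - intros x y z [-> | (n & Hn & Hlt)]; [auto|]. intros [<- | (m & Hm & Hlt')]; right.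
    + exists n; auto.
    + exists (min n m). split.
      * intros j Hj. rewrite Hn, Hm by lia. auto.
      * destruct (Nat.lt_trichotomy n m) as [H | [-> | H]].
        -- rewrite Nat.min_l by lia. rewrite <- (Hm n H). auto.
        -- rewrite Nat.min_id. lia.
        -- rewrite Nat.min_r by lia. rewrite (Hn m H). auto.
  - intros x y z [-> | (n & Hn & Hlt)] Hzy; [rewrite dist_refl; pose proof (dist_ge0 z y); lra|].
    destruct Hzy as [<- | (m & Hm & Hlt')]; [pose proof (dist_ge0 x z); lra|].
    (* As [z] precedes [y], the points [x] and [y] are separated at some scale [j] no later than the
       first one separating [x] from [z]. So [d x y] is at least [M / 2^j], while [d x z] is below
       [M / 2^(j-1)] if [j > 0]: the 2 is the ratio of consecutive scales. *)
    assert (Hj : exists j, (j <= n)%nat /\ e j x <> e j y).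
    { destruct (Nat.le_gt_cases n m) as [H | H].
      - exists n. split; auto. destruct (Nat.eq_dec n m) as [-> |]; [lia|].
        rewrite <- (Hm n) by lia. lia.
      - exists m. split; [lia|]. rewrite (Hn m) by lia. lia. }
    destruct Hj as (j & Hjn & Hj).
    assert (Hxy : M * (/ 2) ^ j <= d x y).
    { apply Rnot_lt_le. intros H. apply Hj, He, H. }
    destruct j as [|j].
    + simpl in Hxy. specialize (Hb x z). lra.
    + assert (Hxz : d x z < M * (/ 2) ^ j) by (apply He, Hn; lia).
      simpl in Hxy. lra.
Qed.

(** * A map to an interval with dense image *)

Lemma interval_map k : (1 <= k)%nat -> inhabited X ->
  exists g : X -> R,
    (forall x, 0 <= g x <= content k (fun _ => True)) /\
    (forall x y, Rabs (g x - g y) <= (2 * d x y) ^ k) /\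
    (forall c eps, 0 <= c <= content k (fun _ => True) -> 0 < eps ->
       exists x, Rabs (g x - c) <= eps).
Proof.
  intros Hk [x0]. destruct convex_order as (le & Htot & Htr & Hconv).
  set (g := fun x => content k (fun z => le z x)).
  (* The segment up to [y] is the segment up to [x] together with the order interval from [x] to
     [y], which lies in the ball of radius [2 * d x y] about [x]. *)
  assert (Hg1 : forall x y, le x y -> g x <= g y <= g x + (2 * d x y) ^ k).
  { intros x y Hxy. split.
    - apply content_mono. intros z Hz. now apply Htr with x.
    - eapply Rle_trans; [apply (content_union_le k _ (fun z => le z x) (fun z => le x z /\ le z y))|].
      + intros z Hz. destruct (Htot z x); auto.
      + apply Rplus_le_compat_l, (content_ball_le k x).
        * pose proof (dist_ge0 x y); lra.
        * intros z [H1 H2]. auto. }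
  assert (Hg : forall x y, Rabs (g x - g y) <= (2 * d x y) ^ k).
  { intros x y. destruct (Htot x y) as [H | H]; specialize (Hg1 _ _ H).
    - apply Rabs_le. lra.
    - rewrite (dist_sym x y). apply Rabs_le. lra. }
  exists g. split; [|split; [exact Hg|]].
  { intros x. split; [apply content_ge0|]. now apply content_mono. }
  intros c eps Hc0 He. apply NNPP. intros Hno.
  assert (Hdich : forall x, g x < c - eps \/ c + eps < g x).
  { intros x. apply NNPP. intros H. apply Hno. exists x. apply Rabs_le. lra. }
  clear Hno.
  (* The bound [1 / 2] gives [2 * r <= 1], so that [(2 * r) ^ k <= 2 * r <= eps / 4]. *)
  set (r := Rmin (1 / 2) (eps / 8)).
  assert (Hr : 0 < r) by (apply Rmin_glb_lt; lra).
  assert (Hrk : (2 * r) ^ k <= eps / 4).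
  { pose proof (Rmin_l (1 / 2) (eps / 8)) as H1. pose proof (Rmin_r (1 / 2) (eps / 8)) as H2.
    fold r in H1, H2. eapply Rle_trans; [apply pow_le_self; auto; lra|lra]. }
  (* The two sides of the supposed gap may have no extremal points, so extrema are taken over a
     finite net. *)
  destruct (finite_net r Hr) as [F HF].
  assert (Hnear : forall f x, d f x < r -> Rabs (g f - g x) <= eps / 4).
  { intros f x Hfx. eapply Rle_trans; [apply Hg|]. eapply Rle_trans; [|apply Hrk].
    apply pow_incr. pose proof (dist_ge0 f x). lra. }
  set (L := fun x => g x < c - eps). set (U := fun x => c + eps < g x).
  (* A net point near [x] is on the same side, since [g] varies by at most [eps / 4] and the gap has
     width [2 * eps]. *)
  assert (HFL : forall x, L x -> exists f, In f F /\ d f x < r /\ L f).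
  { intros x Hx. destruct (HF x) as (f & Hf & Hfx). exists f. repeat split; auto.
    pose proof (Hnear f x Hfx) as H. unfold L in *. destruct (Hdich f); auto.
    unfold Rabs in H; destruct Rcase_abs; lra. }
  assert (HFU : forall x, U x -> exists f, In f F /\ d f x < r /\ U f).
  { intros x Hx. destruct (HF x) as (f & Hf & Hfx). exists f. repeat split; auto.
    pose proof (Hnear f x Hfx) as H. unfold U in *. destruct (Hdich f); auto.
    unfold Rabs in H; destruct Rcase_abs; lra. }
  (* The strict form settles the case where [L] is the whole space, whose content is at least
     [c]. *)
  assert (HL : content k L <= c /\ (L x0 -> content k L < c)).
  { destruct (finite_max le L F Htot Htr) as [Hnone | (m & Hm & HLm & Hmax)].
    - assert (HLe : forall x, ~ L x).
      { intros x Hx. destruct (HFL x Hx) as (f & Hf & _ & HLf). apply (Hnone f Hf HLf). }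
      rewrite (content_empty k L HLe). split; [lra|]. intros H; destruct (HLe _ H).
    - assert (content k L <= g m + (2 * r) ^ k); [|unfold L in HLm; split; intros; lra].
      eapply Rle_trans; [apply (content_union_le k L (fun z => le z m) (fun z => d m z <= 2 * r))|].
      + intros z Hz. destruct (Htot z m) as [|Hmz]; [auto|right].
        (* The net point [f] near [z] satisfies [f <= m <= z] in the order, so convexity puts [m]
           close to [f], hence to [z]. *)
        destruct (HFL z Hz) as (f & Hf & Hfz & HLf).
        pose proof (Hconv f z m (Hmax f Hf HLf) Hmz).
        apply (dist_common m z f); lra.
      + apply Rplus_le_compat_l, (content_ball_le k m); [lra|auto]. }
  destruct (finite_max (fun x y => le y x) U F) as [Hnone | (m & Hm & HUm & Hmin)]; eauto.
  - assert (HLall : forall x, L x).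
    { intros x. destruct (Hdich x) as [|Hx]; auto.
      destruct (HFU x Hx) as (f & Hf & _ & HUf). destruct (Hnone f Hf HUf). }
    destruct HL as [_ HL]. specialize (HL (HLall x0)).
    pose proof (content_mono k (fun _ => True) L ltac:(auto)). lra.
  (* Up to the least net point [m] of [U], the initial segment exceeds [L] only inside a ball of
     radius [2 * r]; so [g m] is at most [c + eps / 4], too small for [U]. *)
  - assert (g m <= content k L + (2 * r) ^ k); [|unfold U in HUm; lra].
    eapply Rle_trans; [apply (content_union_le k _ L (fun z => d m z <= 2 * r))|].
    + intros z Hz. destruct (Hdich z) as [|HUz]; [auto|right].
      destruct (HFU z HUz) as (f & Hf & Hfz & HUf).
      pose proof (Hconv z f m Hz (Hmin f Hf HUf)) as H.
      rewrite (dist_sym z f) in H. rewrite dist_sym. lra.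
    + apply Rplus_le_compat_l, (content_ball_le k m); [lra|auto].
Qed.

(** * Construction of the map *)

(** If [y] were missed, the open sets where some coordinate is off by more than [1/(n+1)] would
    cover the space; a finite subcover keeps the image uniformly away from [y]. *)
Lemma dense_image_onto k f L : 0 <= L ->
  (forall x y i, (i < k)%nat -> Rabs (f x i - f y i) <= L * d x y) ->
  (forall y eps, in_cube k y -> 0 < eps ->
     exists x, forall i, (i < k)%nat -> Rabs (f x i - y i) <= eps) ->
  forall y, in_cube k y -> exists x, forall i, (i < k)%nat -> f x i = y i.
Proof.
  intros HL Hlip Hdense y Hy. apply NNPP. intros Hno.
  destruct (Hc nat (fun n x => exists i, (i < k)%nat /\ / INR (S n) < Rabs (f x i - y i))) as [l Hl].
  - intros n x (i & Hi & Hx).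
    (* Within [r] the coordinate moves by less than its excess over [/ INR (S n)]; the [+ 1] avoids
       dividing by zero. *)
    set (r := (Rabs (f x i - y i) - / INR (S n)) / (L + 1)).
    assert (Hr : 0 < r) by (apply Rdiv_lt_0_compat; lra).
    exists r. split; auto. intros z Hz. exists i. split; auto.
    assert (Hrr : (L + 1) * r = Rabs (f x i - y i) - / INR (S n)) by
      (unfold r; generalize (Rabs (f x i - y i) - / INR (S n)); intros; field; lra).
    specialize (Hlip x z i Hi). pose proof (dist_ge0 x z).
    assert (Rabs (f x i - f z i) < Rabs (f x i - y i) - / INR (S n)) by nra.
    pose proof (Rabs_triang (f x i - f z i) (f z i - y i)) as T.
    replace (f x i - f z i + (f z i - y i)) with (f x i - y i) in T by ring. lra.
  - intros x. apply NNPP. intros Hn. apply Hno. exists x. intros i Hi.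
    apply NNPP. intros Hne.
    assert (Hp : 0 < Rabs (f x i - y i)) by (apply Rabs_pos_lt; lra).
    destruct (archimed_cor1 _ Hp) as (n & Hn1 & Hn2).
    apply Hn. exists (n - 1)%nat, i. split; auto. now replace (S (n - 1)) with n by lia.
  - destruct (list_nat_bound l) as [N HN].
    assert (HNp : 0 < INR (S N)) by (apply lt_0_INR; lia).
    destruct (Hdense y (/ INR (S N)) Hy) as [x Hx]; [now apply Rinv_0_lt_compat|].
    destruct (Hl x) as (n & Hn & i & Hi & Hlt). specialize (Hx i Hi). specialize (HN n Hn).
    assert (/ INR (S N) <= / INR (S n)).
    { apply Rinv_le_contravar; [apply lt_0_INR; lia|apply le_INR; lia]. }
    lra.
Qed.

Theorem measure_pos_lipschitz_onto_cube k : (1 <= k)%nat -> hausdorff_measure_pos d k ->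
  exists f : X -> nat -> R, lipschitz d k f /\ onto_cube k f.
Proof.
  intros Hk Hpos. pose proof (content_pos k Hk Hpos) as HH.
  assert (Hinh : inhabited X).
  { apply NNPP. intros Hn. rewrite content_empty in HH; [lra|].
    intros x _. apply Hn. now constructor. }
  destruct (interval_map k Hk Hinh) as (g & Hgr & Hgl & Hgd).
  destruct (peano_curve k Hk) as (P & HPc & (C & HC & HPl) & HPd).
  set (H := content k (fun _ => True)) in *.
  assert (Hrange : forall x, 0 <= g x / H <= 1).
  { intros x. specialize (Hgr x). split; [now apply Rle_mult_inv_pos|].
    apply (Rmult_le_reg_r H); auto. field_simplify; lra. }
  assert (Hdiff : forall a b, Rabs (a / H - b / H) = Rabs (a - b) / H).
  { intros a b. unfold Rdiv. rewrite <- Rmult_minus_distr_r, Rabs_mult.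
    rewrite (Rabs_right (/ H)); auto. left. now apply Rinv_0_lt_compat. }
  set (f := fun x => P (g x / H)).
  (* Since [K >= 1], its [k]-th power dominates [C * 2 ^ k / H], which avoids extracting a [k]-th
     root. *)
  set (K := 1 + C * 2 ^ k / H).
  assert (HK1 : 0 < C * 2 ^ k / H).
  { apply Rdiv_lt_0_compat; auto. apply Rmult_lt_0_compat; auto. apply pow_lt; lra. }
  assert (Hlip : forall x y i, (i < k)%nat -> Rabs (f x i - f y i) <= K * d x y).
  { intros x y i Hi. pose proof (dist_ge0 x y) as Hxy.
    apply (pow_le_reg_l k); auto; [apply Rmult_le_pos; [unfold K; lra|auto]|].
    eapply Rle_trans; [apply HPl; auto|].
    rewrite Hdiff. specialize (Hgl x y). rewrite Rpow_mult_distr in *.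
    assert (HKk : C * 2 ^ k / H <= K ^ k).
    { apply Rle_trans with (K ^ 1); [unfold K; lra|]. apply Rle_pow; auto. unfold K; lra. }
    apply Rle_trans with (C * (2 ^ k * d x y ^ k / H)).
    - apply Rmult_le_compat_l; [lra|]. apply Rmult_le_compat_r; auto.
      left. now apply Rinv_0_lt_compat.
    - replace (C * (2 ^ k * d x y ^ k / H)) with (C * 2 ^ k / H * d x y ^ k) by (field; lra).
      apply Rmult_le_compat_r; auto. now apply pow_le. }
  exists f. split; [|split].
  - exists (INR k * K). split; [apply Rmult_le_pos; [apply pos_INR|unfold K; lra]|].
    intros x y. rewrite Rmult_assoc. apply eucl_dist_le; auto.
    pose proof (dist_ge0 x y). apply Rmult_le_pos; [unfold K; lra|auto].
  - intros x. now apply HPc.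
  - apply (dense_image_onto k f K); [unfold K; lra|auto|].
    intros y eps Hy He.
    destruct (HPd y (eps / 2) Hy) as (t & Ht & Hty); [lra|].
    (* Chosen so that an error [eta] in [g] becomes an error [eps / 2] after rescaling by [H] and
       applying the Hoelder bound. *)
    set (eta := (eps / 2) ^ k / C * H).
    assert (Heta : 0 < eta).
    { apply Rmult_lt_0_compat; auto. apply Rdiv_lt_0_compat; auto. apply pow_lt; lra. }
    destruct (Hgd (t * H) eta) as [x Hx]; [nra|auto|].
    exists x. intros i Hi. specialize (Hty i Hi).
    assert (Hnear : Rabs (f x i - P t i) <= eps / 2).
    { apply (pow_le_reg_l k); auto; [lra|].
      eapply Rle_trans; [apply HPl; auto|].
      replace t with (t * H / H) at 1 by (field; lra). rewrite Hdiff.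
      replace ((eps / 2) ^ k) with (C * (eta / H)) by (unfold eta; field; lra).
      apply Rmult_le_compat_l; [lra|]. apply Rmult_le_compat_r; auto.
      left. now apply Rinv_0_lt_compat. }
    pose proof (Rabs_triang (f x i - P t i) (P t i - y i)) as T.
    replace (f x i - P t i + (P t i - y i)) with (f x i - y i) in T by ring. lra.
Qed.

End Ultrametric.

Theorem theorem1p2 (X : Type) (d : X -> X -> R)
  (Hd : is_ultrametric d) (Hc : compact_space d) (k : nat) (Hk : (1 <= k)%nat) :
  (exists f : X -> nat -> R, lipschitz d k f /\ onto_cube k f) <->
  hausdorff_measure_pos d k.
Proof.
  split.
  - intros (f & Hlip & Honto). now apply (lipschitz_onto_cube_measure_pos d Hd Hc k f).
  - now apply measure_pos_lipschitz_onto_cube.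
Qed.
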